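(* There is an algorithm which, given a finite, simple, connected graph $G$ of even order $n$, runs in $O(n^2)$ time and outputs a solution $S$ to the Edge-Vertex Problem for $G$ satisfying $|S|\le 2(1-1/n)\,|S_{opt}|$, where $|S_{opt}|$ is the minimum cardinality of a solution to the Edge-Vertex Problem for $G$.
   Context: For a graph $G=(V,E)$, a solution to the Edge-Vertex Problem is a subset $X\subseteq E$ such that for every vertex $v\in V$ the number of edges of $X$ incident with $v$ is odd. An optimal solution $S_{opt}$ is a solution of minimum cardinality. *)

(* Defs.v *)
From mathcomp Require Import all_boot all_order all_algebra.

Set Implicit Arguments.
Unset Strict Implicit.
Unset Printing Implicit Defensive.

Section EdgeVertex.

Variables (V : finType) (e : rel V).

(* The null graph does not count as connected. *)
Definition connected_graph : Prop := 0 < #|V| /\ forall x y : V, connect e x y.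

(* For e symmetric and irreflexive, the edges are two-element vertex sets. *)
Definition edges : {set {set V}} :=
  [set A : {set V} | [exists x, exists y, e x y && (A == [set x; y])]].

Definition solution (X : {set {set V}}) : Prop :=
  X \subset edges /\ forall v : V, odd #|[set A in X | v \in A]|.

Definition optimal_solution (X : {set {set V}}) : Prop :=
  solution X /\ forall Y : {set {set V}}, solution Y -> #|X| <= #|Y|.

(* Row-major; the vertices are numbered by their position in enum V. *)
Definition adj_matrix (r : rel V) : seq nat :=
  [seq nat_of_bool (r x y) | x <- enum V, y <- enum V].

End EdgeVertex.

(* A word RAM in the usual sense: each instruction takes one unit of time, and
   every register and memory cell holds a natural number below a bound W.  A
   word length of O(log n) bits means that W is at most polynomial in n. *)
Inductive instr :=
| Const (d k : nat)
| Add (d a b : nat)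
| Sub (d a b : nat)
| Mul (d a b : nat)
| Read (d a : nat)
| Write (a s : nat)
| Jump (l : nat)
| JumpLt (a b l : nat).

Definition program := seq instr.

Record config := Config { pc : nat; reg : nat -> nat; cell : nat -> nat }.

Definition upd (f : nat -> nat) (i v : nat) : nat -> nat :=
  fun j => if j == i then v else f j.

Definition exec (i : instr) (c : config) : config :=
  let: Config k r m := c in
  match i with
  | Const d v => Config k.+1 (upd r d v) m
  | Add d a b => Config k.+1 (upd r d (r a + r b)) m
  | Sub d a b => Config k.+1 (upd r d (r a - r b)) m
  | Mul d a b => Config k.+1 (upd r d (r a * r b)) m
  | Read d a => Config k.+1 (upd r d (m (r a))) m
  | Write a s => Config k.+1 r (upd m (r a) (r s))
  | Jump l => Config l r m
  | JumpLt a b l => Config (if r a < r b then l else k.+1) r m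
  end.

Definition fits (W : nat) (c : config) : Prop :=
  forall i, reg c i < W /\ cell c i < W.

(* runs W p t c c': started in c, the program p halts in c' after exactly t
   steps (by leaving the range of its code), and no word overflows on the way. *)
Inductive runs (W : nat) (p : program) : nat -> config -> config -> Prop :=
| RunsHalt c : fits W c -> onth p (pc c) = None -> runs W p 0 c c
| RunsStep i t c c' : fits W c -> onth p (pc c) = Some i ->
    runs W p t (exec i c) c' -> runs W p t.+1 c c'.

(* Register 0 holds the order of the graph, the memory holds its adjacency
   matrix from address 0 on, and everything else is 0. *)
Definition input (V : finType) (e : rel V) : config :=
  Config 0 (upd (fun=> 0) 0 #|V|) (nth 0 (adj_matrix e)).

(* The output overwrites the input: it is the adjacency matrix of (V, S). *)
Definition outputs (V : finType) (c : config) (S : {set {set V}}) : Prop :=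
  mkseq (cell c) (#|V| ^ 2) = adj_matrix [rel x y | [set x; y] \in S].

Definition bigO (f g : nat -> nat) : Prop :=
  exists C N : nat, forall n : nat, N <= n -> f n <= C * g n.

(* Main.v *)
Require Import Defs.
From mathcomp Require Import all_boot all_order all_algebra.
From mathcomp Require Import zify.

(* A breadth-first search over the adjacency matrix finds a spanning tree in
   O(n^2) steps.  Vertices are then removed in the reverse order of discovery:
   each one, when removed, takes the edge to its parent exactly if its degree is
   still even.  All vertices but the root end with odd degree, and the root too,
   since the degrees add up to an even number and n is even.  The result uses at
   most n - 1 edges, while any solution has at least n / 2 edges because no
   degree is 0; and n - 1 = 2 (1 - 1/n) (n / 2). *)

Set Implicit Arguments.
Unset Strict Implicit.
Unset Printing Implicit Defensive.

Import Order.TTheory GRing.Theory Num.Theory.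

(** * Graph theory: building the join vertex by vertex, and the ratio bound *)

Section TreeJoin.

Variables (V : finType) (e : rel V).
Hypothesis e_irr : irreflexive e.

Implicit Types (x y u v : V) (X : {set {set V}}) (R : {set V}).

Definition deg X v := #|[set A in X | v \in A]|.

Lemma edge_neq u v : e u v -> u != v.
Proof. by apply: contraTneq => ->; rewrite e_irr. Qed.

(** Handshake lemma: incidences are counted by edges instead of vertices, and irreflexivity gives
    every edge two distinct ends. *)
Lemma sum_deg X : X \subset edges e -> \sum_v deg X v = 2 * #|X|.
Proof.
move=> sub.
under eq_bigr => v _ do rewrite /deg -sum1dep_card.
rewrite (exchange_big_dep [in X]) /=; last by move=> v A _ /andP[].
rewrite mulnC -sum_nat_const; apply: eq_bigr => A AX.
have /existsP[x /existsP[y /andP[exy /eqP defA]]] :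
  [exists x, exists y, e x y && (A == [set x; y])].
  by have := subsetP sub A AX; rewrite inE.
transitivity #|A|; last by rewrite defA cards2 edge_neq.
by rewrite -sum1_card; apply: eq_bigl => v; rewrite AX.
Qed.

Lemma solution_lb X : solution e X -> #|V| <= 2 * #|X|.
Proof.
case=> sub oddX; rewrite -(sum_deg sub) -sum1_card.
by apply: leq_sum => v _; have := oddX v; rewrite -/(deg X v); case: deg.
Qed.

Lemma set2_eq x y u v :
  ([set x; y] == [set u; v]) = (x == u) && (y == v) || (x == v) && (y == u).
Proof.
apply/eqP/idP => [E|/orP[] /andP[/eqP-> /eqP->] //]; last exact: setUC.
have := set21 x y; have := set22 x y; rewrite E !inE.
have := set21 u v; have := set22 u v; rewrite -E !inE.
by rewrite ![u == _]eq_sym ![v == _]eq_sym;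
  do 4!case: eqP => // _.
Qed.

(* A join under construction, with R the set of vertices still to be treated. *)
Definition partial_join R X :=
  [/\ X \subset edges e,
      forall A, A \in X -> ~~ (A \subset R) &
      forall v, v \notin R -> odd (deg X v)].

(** Modulo 2 the degrees off [r] sum to [n - 1], which is odd, while the total is even by [sum_deg];
    so the degree of [r] is odd. *)
Lemma partial_join1 X r :
  ~~ odd #|V| -> partial_join [set r] X -> solution e X.
Proof.
move=> evenV [sub _ oddX]; split=> // v; rewrite -/(deg X v).
have [->|/negbTE nvr] := eqVneq v r; last by apply: oddX; rewrite !inE nvr.
have : ~~ odd (\sum_v deg X v) by rewrite sum_deg // mul2n odd_double.
rewrite (bigD1 r) //= oddD.
suff -> : odd (\sum_(i | i != r) deg X i) by case: odd.
have -> : odd (\sum_(i | i != r) deg X i) = odd (\sum_(i | i != r) 1).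
  rewrite !(big_morph odd oddD (erefl _)).
  by apply: eq_bigr => i ir; rewrite oddX ?inE.
rewrite sum1_card; have := evenV; have := cardC1 r.
rewrite -(@eq_card _ (predC1 r)) // => ->.
have : 0 < #|V| by apply/card_gt0P; exists r.
by case: #|V| => //= n _; rewrite negbK.
Qed.

Definition join_step u v X := if odd (deg X v) then X else [set u; v] |: X.

(** The edge [[set u; v]] lies inside [R], so it is not in [X], and adding it flips exactly the
    parities at [u] and [v]. The last two clauses are in the form of the memory updates that the
    program performs: two matrix entries and one parity flag. *)
Lemma join_stepP R u v X (X' := join_step u v X) :
  v \in R -> u \in R -> e u v -> partial_join R X ->
  [/\ partial_join (R :\ v) X',
      #|X'| <= #|X|.+1,
      forall x y, [set x; y] \in X' =
        if (x == u) && (y == v) || (x == v) && (y == u)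
        then ~~ odd (deg X v) else [set x; y] \in X &
      forall y, y != v ->
        odd (deg X' y) = odd (deg X y) (+) ((y == u) && ~~ odd (deg X v))].
Proof.
move=> vR uR euv [sub touch oddX].
have nuv := edge_neq euv.
have notX : [set u; v] \notin X.
  by apply/negP => /touch; rewrite subUset !sub1set uR vR.
have degX' y : deg X' y = deg X y + ((y \in [set u; v]) && ~~ odd (deg X v)).
  rewrite /X' /join_step; case: (boolP (odd (deg X v))) => /= o.
    by rewrite andbF addn0.
  rewrite andbT /deg.
  have -> : [set A in [set u; v] |: X | y \in A] =
    (if y \in [set u; v] then [set [set u; v]] else set0)
      :|: [set A in X | y \in A].
    apply/setP=> A; rewrite !inE.
    case: (eqVneq A [set u; v]) => [->|nA] /=; last first.
      by case: ifP; rewrite ?inE ?(negbTE nA).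
    by rewrite !inE; case: ifP => H; rewrite ?inE ?eqxx //= andbF.
  case: ifP => _; last by rewrite set0U addn0.
  by rewrite cardsU1 inE (negbTE notX) addnC.
have memX' x y : [set x; y] \in X' =
    if (x == u) && (y == v) || (x == v) && (y == u)
    then ~~ odd (deg X v) else [set x; y] \in X.
  rewrite -set2_eq /X' /join_step.
  case: (boolP (odd (deg X v))) => /= o; rewrite ?inE.
    by case: eqP => // ->; rewrite (negbTE notX).
  by case: eqP.
split=> //.
- split.
  + rewrite /X' /join_step; case: ifP => // _.
    rewrite subUset sub andbT sub1set inE.
    by apply/existsP; exists u; apply/existsP; exists v; rewrite euv eqxx.
  + move=> A; rewrite /X' /join_step; case: ifP => _.
      move=> /touch; apply: contra => /subset_trans; apply; exact: subsetDl.
    rewrite !inE => /orP[/eqP->|/touch].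
      by rewrite subUset !sub1set !inE eqxx andbF.
    by apply: contra => /subset_trans; apply; exact: subsetDl.
  + move=> y; rewrite !inE negb_and negbK degX' oddD oddb => /orP[/eqP->|nyR].
      by rewrite !inE eqxx orbT; case: odd.
    rewrite oddX // !inE.
    have /negbTE -> : y != u by apply: contraNneq nyR => ->.
    by have /negbTE -> : y != v by apply: contraNneq nyR => ->.
- rewrite /X' /join_step; case: ifP => _ //; rewrite cardsU1 (negbTE notX); lia.
- by move=> y /negbTE nyv; rewrite degX' oddD oddb !inE nyv orbF.
Qed.

Lemma partial_join0 : partial_join setT set0.
Proof. by split=> [|A|v]; rewrite ?sub0set ?inE. Qed.

Lemma deg0 v : deg set0 v = 0.
Proof.
by rewrite /deg -(cards0 {set V}); apply: eq_card => A; rewrite !inE.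
Qed.

(** Multiplied by [n], the claim is the product of [#|S| <= n - 1] and [n <= 2 * #|X|]. *)
Lemma join_ratio (S X : {set {set V}}) : 0 < #|V| -> #|S| < #|V| ->
  solution e X -> (#|S|%:R <= 2 * (1 - #|V|%:R^-1) * #|X|%:R :> rat)%R.
Proof.
move=> V0 SV /solution_lb; move: SV V0; move: #|V| #|S| #|X| => n s k sn n0 nk.
have nR : (0 < n%:R :> rat)%R by rewrite ltr0n.
rewrite -(ler_pM2l nR).
have -> : (n%:R * (2 * (1 - n%:R^-1) * k%:R) = (2 * k)%:R * n.-1%:R :> rat)%R.
  rewrite natrM -[in n.-1]subn1 natrB // mulrA mulrCA mulrBr divff ?gt_eqF //.
  by rewrite mulr1 mulrAC.
rewrite -!natrM ler_nat leq_mul //; lia.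
Qed.

End TreeJoin.

(** * Timed Hoare triples and symbolic execution for the word RAM *)

Section Machine.

Variables (W : nat) (p : program).

(* Quantifying over the continuation makes this relation transitive for free. *)
Definition reach t c c' := forall s d, runs W p s c' d -> runs W p (t + s) c d.

Definition triple t (P Q : config -> Prop) :=
  forall c, P c -> exists t' c', [/\ t' <= t, reach t' c c' & Q c'].

Lemma triple_seq t1 t2 P Q R :
  triple t1 P Q -> triple t2 Q R -> triple (t1 + t2) P R.
Proof.
move=> PQ QR c /PQ[s1 [c1 [le1 r1 /QR[s2 [c2 [le2 r2 Rc]]]]]].
exists (s1 + s2), c2; split=> //; first exact: leq_add.
by move=> s d /r2 /r1; rewrite addnA.
Qed.

Lemma triple_iter t m (P : nat -> config -> Prop) :
  (forall k, k < m -> triple t (P k) (P k.+1)) -> triple (m * t) (P 0) (P m).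
Proof.
elim: m => [|m IH] step; first by move=> c Pc; exists 0, c; split.
rewrite mulSnr; apply: triple_seq (IH _) (step m _) => // k km.
by apply: step; apply: ltnW.
Qed.

(** Only these three instructions can create a word too large: truncated subtraction does not exceed
    its first argument, and the others copy words or jump. *)
Definition no_overflow (i : instr) (c : config) : Prop :=
  match i with
  | Const _ v => v < W
  | Add _ a b => reg c a + reg c b < W
  | Mul _ a b => reg c a * reg c b < W
  | _ => True
  end.

Lemma fits_exec i c : fits W c -> no_overflow i c -> fits W (exec i c).
Proof.
case: c i => k r m [d v|d a b|d a b|d a b|d a|a s|l|a b l] /= fc lt j /=;
  have [rj mj] := fc j; rewrite /upd; do ?[split=> //]; case: ifP => //= _.
- exact: leq_ltn_trans (leq_subr _ _) (fc a).1.
- exact: (fc (r a)).2.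
- exact: (fc s).1.
Qed.

(* A copy of exec that computes by cbv on registers while leaving memory updates
   folded: register numbers are literals, memory addresses are not. *)
Definition set_reg (r : nat -> nat) i v j := if eqn j i then v else r j.

Definition exec' (i : instr) (c : config) : config :=
  let: Config k r m := c in
  match i with
  | Const d v => Config k.+1 (set_reg r d v) m
  | Add d a b => Config k.+1 (set_reg r d (r a + r b)) m
  | Defs.Sub d a b => Config k.+1 (set_reg r d (r a - r b)) m
  | Mul d a b => Config k.+1 (set_reg r d (r a * r b)) m
  | Read d a => Config k.+1 (set_reg r d (m (r a))) m
  | Write a s => Config k.+1 r (upd m (r a) (r s))
  | Jump l => Config l r m
  | JumpLt a b l => Config (if r a < r b then l else k.+1) r m
  end.

Lemma exec'E i c : exec' i c = exec i c.
Proof. by case: c; case: i. Qed.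

Fixpoint trace k c : config :=
  if k is k'.+1 then
    if onth p (pc c) is Some i then trace k' (exec' i c) else c
  else c.

Fixpoint trace_ok k c : Prop :=
  if k is k'.+1 then
    if onth p (pc c) is Some i then no_overflow i c /\ trace_ok k' (exec' i c)
    else False
  else True.

Lemma traceP k c : fits W c -> trace_ok k c ->
  fits W (trace k c) /\ reach k c (trace k c).
Proof.
elim: k c => [|k IH] c fc /=; first by split.
case E: (onth p (pc c)) => [i|] //; rewrite exec'E => -[oi /IH[|ft rt]].
  exact: fits_exec.
by split=> // s d /rt; apply: RunsStep E.
Qed.

(** Reduces a block of [k] instructions to computation. The postcondition may assume [fits] of the
    final state, so invariants that contain [fits] get that part for free. *)
Lemma triple_trace k (P Q : config -> Prop) :
  (forall c, P c -> [/\ fits W c, trace_ok k c &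
     fits W (trace k c) -> Q (trace k c)]) -> triple k P Q.
Proof.
move=> PQ c /PQ[fc /(traceP fc)[ft rt] Qt].
by exists k, (trace k c); split=> //; apply: Qt.
Qed.

End Machine.

(* Registers: 0 holds n, 1 to 3 hold N, 2N, 3N with N = n^2, 4 holds 1, 16 holds
   0, 5 is the position in the queue, 6 the inner loop counter, 7 the length of
   the queue; from 8 on there are temporaries.  Memory: the matrix at 0, the
   marks of discovered vertices at N, the queue at 2N, the parents of its
   entries at 3N.  The search writes each candidate behind the end of the queue
   and advances the end by 0 or 1.  When the search is over all marks are 1, and
   the last phase (from 32 on) uses them as "degree still even" flags. *)
Definition code : program := [::
  Const 4 1; Mul 1 0 0; Add 2 1 1; Add 3 2 1; Write 1 4; Const 7 1;
  Add 10 2 5; Read 8 10; Mul 9 8 0; Const 6 0;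
  Add 10 9 6; Read 11 10; Add 12 1 6; Read 13 12; Defs.Sub 14 4 13;
  Mul 11 11 14;
  Add 13 13 11; Write 12 13; Add 10 2 7; Write 10 6; Add 10 3 7; Write 10 8;
  Add 7 7 11; Add 6 6 4; JumpLt 6 0 10;
  Add 5 5 4; JumpLt 5 0 6;
  Const 6 0; Const 10 0;
  Write 6 10; Add 6 6 4; JumpLt 6 1 29;
  Defs.Sub 5 0 4;
  Add 10 2 5; Read 8 10; Add 10 3 5; Read 9 10; Add 10 1 8; Read 11 10;
  Mul 12 9 0; Add 12 12 8; Write 12 11; Mul 12 8 0; Add 12 12 9; Write 12 11;
  Add 12 1 9; Read 13 12; Defs.Sub 14 11 13; Defs.Sub 15 13 11; Add 13 14 15;
  Write 12 13; Defs.Sub 5 5 4; JumpLt 16 5 33].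

Lemma nth_allpairs (S T U : Type) (f : S -> T -> U) a b c s t i j :
  i < size s -> j < size t ->
  nth c (allpairs f s t) (i * size t + j) = f (nth a s i) (nth b t j).
Proof.
move=> + jt; elim: s i => [|x s IH] [|i] //= lt; rewrite nth_cat size_map.
  by rewrite jt (nth_map b).
by rewrite mulSn -addnA ltnNge leq_addr /= addKn IH.
Qed.

(** * Vertex numbers and row-major matrix addresses *)

Section Numbering.

Variables (V : finType).

Definition rk (x : V) : nat := index x (enum V).

Lemma rk_lt x : rk x < #|V|.
Proof. by rewrite cardT index_mem mem_enum. Qed.

Lemma rk_inj : injective rk.
Proof.
move=> x y E; rewrite -(nth_index x (mem_enum V x)) -/(rk x) E.
by rewrite nth_index ?mem_enum.
Qed.

Lemma rk_onto i : i < #|V| -> exists x, rk x = i.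
Proof.
rewrite cardT => lt.
have [x _] : exists x : V, true by case: (enum V) lt => // x; exists x.
by exists (nth x (enum V) i); rewrite /rk index_uniq // enum_uniq.
Qed.

Lemma size_adj_matrix (r : rel V) : size (adj_matrix r) = #|V| ^ 2.
Proof. by rewrite size_allpairs -cardT. Qed.

Lemma nth_adj_matrix (r : rel V) x y :
  nth 0 (adj_matrix r) (rk x * #|V| + rk y) = r x y.
Proof.
rewrite {1}cardT (nth_allpairs _ x y) -?cardT ?rk_lt //.
by rewrite !nth_index ?mem_enum.
Qed.

Lemma rk_pair k : k < #|V| ^ 2 -> exists x y, k = rk x * #|V| + rk y.
Proof.
move=> lt; have n0 : 0 < #|V| by case: #|V| lt.
have [x Ex] : exists x, rk x = k %/ #|V| by apply: rk_onto; rewrite ltn_divLR.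
have [y Ey] : exists y, rk y = k %% #|V| by apply: rk_onto; rewrite ltn_pmod.
by exists x, y; rewrite Ex Ey -divn_eq.
Qed.

Lemma rk_pair_lt x y : rk x * #|V| + rk y < #|V| ^ 2.
Proof. by have := rk_lt x; have := rk_lt y; nia. Qed.

Lemma rk_pair_inj x y u v :
  (rk x * #|V| + rk y == rk u * #|V| + rk v) = (x == u) && (y == v).
Proof.
apply/eqP/andP => [E|[/eqP-> /eqP->] //].
have n0 := leq_ltn_trans (leq0n _) (rk_lt x).
have := congr1 (divn^~ #|V|) E; have := congr1 (modn^~ #|V|) E.
rewrite !modnMDl !divnMDl // !modn_small ?rk_lt // !divn_small ?rk_lt //.
by rewrite !addn0 => /rk_inj-> /rk_inj->.
Qed.

Lemma outputs_mem (c : config) (S : {set {set V}}) :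
  (forall x y, cell c (rk x * #|V| + rk y) = ([set x; y] \in S)) -> outputs c S.
Proof.
move=> H; apply: (@eq_from_nth _ 0) => [|k].
  by rewrite size_mkseq size_adj_matrix.
rewrite size_mkseq => lt; rewrite nth_mkseq //.
by have [x [y ->]] := rk_pair lt; rewrite H nth_adj_matrix.
Qed.

End Numbering.

Ltac sim := cbv beta iota zeta delta
  [trace trace_ok exec' code onth no_overflow reg cell pc set_reg eqn].

(** * Loop invariants of the program, beginning with the breadth-first search *)

Section Algorithm.

Variables (V : finType) (e : rel V) (x0 : V).
Hypothesis e_irr : irreflexive e.
Hypotheses (e_conn : forall x y, connect e x y) (rk_x0 : rk x0 = 0).
(* N is kept abstract so that lia treats it as an atom. *)
Hypothesis (n_gt1 : 1 < #|V|).
Variables (N W : nat).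
Hypotheses (N_def : N = #|V| ^ 2) (n_lt_N : #|V| < N) (N_lt_W : 4 * N <= W).

Notation n := #|V|.
Notation d := (x0, x0).

Implicit Types (s : seq (V * V)) (x y u v : V) (r m : nat -> nat).

(** Entries are pairs (vertex, parent) in order of discovery. Entry 0 is the root, whose parent
    component is a dummy, hence the condition [0 < i]. *)
Definition tree_order s := uniq (unzip1 s) /\ forall i, 0 < i < size s ->
  (nth d s i).2 \in unzip1 (take i s) /\ e (nth d s i).2 (nth d s i).1.

(** Rows before [h] are scanned completely, row [h] up to column [k]. Once [size s <= h], this says
    that the discovered vertices are closed under adjacency. *)
Definition explored s h k := forall j y, j < size s -> e (nth d s j).1 y ->
  (j < h) || (j == h) && (rk y < k) -> y \in unzip1 s.

Definition visit s h y :=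
  let u := (nth d s h).1 in
  if e u y && (y \notin unzip1 s) then rcons s (y, u) else s.

Lemma tree_order_size s : tree_order s -> size s <= n.
Proof.
by case=> us _; rewrite -(size_map (@fst V V)) -(card_uniqP us) max_card.
Qed.

Lemma size_visit s h y :
  size (visit s h y) = size s + e (nth d s h).1 y * (1 - (y \in unzip1 s)).
Proof.
by rewrite /visit; case: (e _ _); case: (y \in _) => //=;
  rewrite ?size_rcons ?addn0 ?addn1 ?muln0.
Qed.

Lemma nth_visit s h y i : i < size s -> nth d (visit s h y) i = nth d s i.
Proof. by rewrite /visit; case: ifP => // _ lt; rewrite nth_rcons lt. Qed.

Lemma mem_visit s h y x : x \in unzip1 (visit s h y) =
  (x \in unzip1 s) || (x == y) && e (nth d s h).1 y.
Proof.
rewrite /visit; case: ifP => [/andP[-> yn]|].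
  by rewrite /unzip1 map_rcons mem_rcons inE orbC andbT.
case: (eqVneq x y) => [->|_]; rewrite ?orbF //.
by case: (e _ _) => //=; case: (y \in _).
Qed.

Lemma tree_order_visit s h y :
  h < size s -> tree_order s -> tree_order (visit s h y).
Proof.
move=> hs [us par]; rewrite /visit.
case: ifP => [/andP[euy yn]|_]; last by split.
split=> [|i]; first by rewrite /unzip1 map_rcons rcons_uniq yn.
rewrite size_rcons ltnS nth_rcons -cats1 => /andP[i0 le]; rewrite takel_cat //.
case: ltnP => [lt|ge]; first by apply: par; rewrite i0.
have -> : i = size s by apply/eqP; rewrite eqn_leq le ge.
by rewrite eqxx take_size; split=> //; apply/map_f/mem_nth.
Qed.

Lemma explored_visit s h y : h < size s ->
  explored s h (rk y) -> explored (visit s h y) h (rk y).+1.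
Proof.
move=> hs ex j z; rewrite mem_visit.
(* A newly appended entry lies beyond [h], so nothing is claimed about its row yet. *)
case: (ltnP j (size s)) => [js _|sj]; last by move=> _ _; lia.
rewrite nth_visit // => ejz.
case: (eqVneq z y) ejz => [->|nzy] ejz.
  case/orP=> [jh|/andP[/eqP jh _]]; first by rewrite (ex j y) ?jh.
  by rewrite -jh ejz orbT.
have ne : rk z != rk y by apply: contra nzy => /eqP/rk_inj->.
have -> : (rk z < (rk y).+1) = (rk z < rk y) by lia.
by move=> /ex->.
Qed.

Definition base r :=
  [/\ r 0 = n, r 1 = N, r 2 = 2 * N, r 3 = 3 * N & r 4 = 1 /\ r 16 = 0].

Definition queue m s := forall i, i < size s ->
  m (2 * N + i) = rk (nth d s i).1 /\ m (3 * N + i) = rk (nth d s i).2.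

Definition marks m s := forall x, m (N + rk x) = (x \in unzip1 s).

Definition matrix m (a : rel V) := forall x y, m (rk x * n + rk y) = a x y.

Definition bfs h k c := exists s,
  [/\ fits W c /\ base (reg c),
      [/\ queue (cell c) s, marks (cell c) s & matrix (cell c) e],
      [/\ reg c 5 = h, reg c 7 = size s & h < size s],
      [/\ tree_order s, nth d s 0 = d & explored s h k] &
      [/\ pc c = if k < n then 10 else 25, reg c 6 = k,
          reg c 8 = rk (nth d s h).1
        & reg c 9 = rk (nth d s h).1 * n]].

Lemma pair_lt_N x y : rk x * n + rk y < N.
Proof. by rewrite N_def rk_pair_lt. Qed.

Lemma bfs_step h k : k < n -> triple W code 15 (bfs h k) (bfs h k.+1).
Proof.
move=> kn; have [y Ey] := rk_onto kn; subst k.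
apply: triple_trace => -[q r m] [s]; cbv beta iota delta [reg cell pc] =>
  -[[fc [R0 R1 R2 R3 [R4 R16]]] [qu ma mx]
  [R5 R7 hs] [ts s0 ex] [-> R6 R8 R9]]; rewrite kn.
have yN := pair_lt_N (nth d s h).1 y; have sn := tree_order_size ts.
have nN := n_lt_N; have NW := N_lt_W.
split; first by [].
  sim; rewrite !(R0, R1, R2, R3, R4, R5, R6, R7, R8, R9) mx ma.
  (* With the product turned into an atom, all overflow checks are linear. *)
  move: (rk (nth d s h).1 * n) yN => a yN; clear - yN sn kn nN NW.
  by case: (e _ _); case: (_ \in _); rewrite /=; repeat split; lia.
move=> ft; exists (visit s h y); rewrite /bfs; split.
- split=> //; split=> //; sim.
- sim; rewrite !(R0, R1, R2, R3, R4, R5, R6, R7, R8, R9) mx ma.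
  split=> [i|x|x z].
  (* The queue and parent arrays are written only at offset [size s]; as [size s <= n < N], no array
     runs into the next and older entries survive. *)
  + case: (ltnP i (size s)) => [si _|si].
      rewrite nth_visit //; have [<- <-] := qu i si; rewrite /upd.
      by clear - si sn nN kn; split; do ![case: eqP => ? //=]; lia.
    move: si; rewrite size_visit /visit.
    case: (e _ y); case: (y \in _) => /= si;
      rewrite ?muln0 ?mul0n ?addn0 => lt; try lia.
    have -> : i = size s by lia.
    rewrite nth_rcons ltnn eqxx /upd !eqxx /=; split=> //.
    by case: eqP => // ?; lia.
  + have xn := rk_lt x.
    rewrite mem_visit /upd eqn_add2l (inj_eq (@rk_inj V)).
    do 2![case: eqP => [?|_]; first lia].
    case: (eqVneq x y) => [->|_]; last by rewrite ma orbF.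
    by case: (e _ _); case: (_ \in _).
  + have := pair_lt_N x z; rewrite -(mx x z) /upd.
    by move: (_ + rk z) => a aN; do ![case: eqP => ? //=]; lia.
- sim; rewrite !(R0, R1, R2, R3, R4, R5, R6, R7, R8, R9) mx ma size_visit.
  by split=> //; lia.
- split; first exact: tree_order_visit.
    by rewrite nth_visit //; lia.
  exact: explored_visit.
- by sim; rewrite !(R0, R1, R2, R3, R4, R5, R6, R7, R8, R9) nth_visit ?addn1.
Qed.

(** The discovered set contains [x0] and is closed under adjacency, so it absorbs any path from
    [x0]. *)
Lemma explored_all s h x : 0 < size s -> nth d s 0 = d -> size s <= h ->
  explored s h 0 -> x \in unzip1 s.
Proof.
move=> s0 hd sh ex; have [p + ->] := connectP (e_conn x0 x).
have : x0 \in unzip1 s by rewrite -[x0]/(d.1) -hd; apply/map_f/mem_nth.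
elim: p x0 => //= y p IH z /(nthP x0)[j]; rewrite size_map => js <- /andP[].
rewrite (nth_map d) // => ejy; apply: IH; apply: ex ejy _ => //.
by rewrite (leq_trans js sh).
Qed.

Lemma spanning_size s :
  tree_order s -> (forall x, x \in unzip1 s) -> size s = n.
Proof.
case=> us _ all; rewrite -(size_map (@fst V V)) -(card_uniqP us).
exact: eq_card.
Qed.

Definition start c :=
  [/\ fits W c /\ pc c = 0, reg c 0 = n, forall i, reg c i.+1 = 0,
      matrix (cell c) e & forall a, N <= a -> cell c a = 0].

Definition bfs_row h c := exists s,
  [/\ fits W c /\ base (reg c),
      [/\ queue (cell c) s, marks (cell c) s & matrix (cell c) e],
      [/\ reg c 5 = h, reg c 7 = size s & 0 < size s],
      [/\ tree_order s, nth d s 0 = d & explored s h 0] &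
      pc c = if h < n then 6 else 27].

Lemma start_step : triple W code 6 start (bfs_row 0).
Proof.
have nN := n_lt_N; have NW := N_lt_W; have nnN : n * n = N by rewrite N_def.
apply: triple_trace => -[q r m]; cbv beta iota delta [start reg cell pc]
  => -[[fc ->] R0 R mx m0]; split; first by [].
  by sim; rewrite !(R0, R) nnN; repeat split; lia.
move=> ft; exists [:: d]; split.
- by split=> //; split; sim; rewrite ?(R0, R) ?nnN //; lia.
- sim; rewrite !(R0, R) nnN; split=> [[|i] //= _|x|x y].
  (* The root entry needs no write: its two cells are still 0, which is the number of [x0]. *)
  + by rewrite rk_x0 /upd !addn0; do ![case: eqP => ? //]; rewrite ?m0; lia.
  + rewrite /upd /= !inE -(inj_eq (@rk_inj V)) rk_x0.
    rewrite -{2}[N]addn0 eqn_add2l; case: eqP => // _; rewrite m0; lia.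
  + have := pair_lt_N x y; rewrite -(mx x y) /upd.
    by move: (_ + rk y) => a aN; case: eqP => //=; lia.
- by sim; rewrite !(R0, R).
- split=> //; first by split=> // -[|i] /=; lia.
  by move=> j y _ _; rewrite ltn0 andbF.
- by sim; rewrite (leq_trans _ n_gt1).
Qed.

Lemma bfs_row_enter h : h < n -> triple W code 4 (bfs_row h) (bfs h 0).
Proof.
move=> hn; have nN := n_lt_N; have NW := N_lt_W.
apply: triple_trace => -[q r m] [s]; cbv beta iota delta [reg cell pc] =>
  -[[fc [R0 R1 R2 R3 [R4 R16]]] [qu ma mx] [R5 R7 s1] [ts s0 ex] ->].
(* This is why the outer loop can count to [n] without testing for an empty queue: an exhausted
   queue already holds all [n] vertices, contradicting [h < n]. *)
have hs : h < size s.
  rewrite ltnNge; apply/negP => sh.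
  have := spanning_size ts (fun x => explored_all x s1 s0 sh ex); lia.
have [Qh _] := qu h hs; have := rk_lt (nth d s h).1 => un.
have uN := pair_lt_N (nth d s h).1 x0; rewrite rk_x0 addn0 in uN.
rewrite hn; split; first by [].
  by sim; rewrite !(R0, R1, R2, R3, R4, R5, R7) Qh; repeat split; lia.
move=> ft; exists s; split.
- by split=> //; split=> //; sim.
- by split; sim.
- by split=> //; sim.
- by split.
- by sim; rewrite !(R0, R1, R2, R3, R4, R5, R7) Qh (leq_trans _ n_gt1).
Qed.

Lemma bfs_row_exit h : h < n -> triple W code 2 (bfs h n) (bfs_row h.+1).
Proof.
move=> hn; have nN := n_lt_N; have NW := N_lt_W.
apply: triple_trace => -[q r m] [s]; cbv beta iota delta [reg cell pc] =>
  -[[fc [R0 R1 R2 R3 [R4 R16]]] [qu ma mx] [R5 R7 hs] [ts s0 ex] [-> _ _ _]].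
rewrite ltnn; split; first by [].
  by sim; rewrite !(R0, R4, R5); repeat split; lia.
move=> ft; exists s; split.
- by split=> //; split=> //; sim.
- by split; sim.
- by sim; rewrite !(R4, R5, R7) addn1; split=> //; lia.
(* Every column number is below [n], so row [h] is now scanned completely. *)
- split=> // j y js ejy; rewrite ltnS leq_eqVlt ltn0 andbF orbF => jh.
  by apply: ex ejy _ => //; rewrite rk_lt andbT orbC.
- by sim; rewrite !(R0, R4, R5) addn1.
Qed.

Lemma bfs_phase : triple W code (n * (4 + n * 15 + 2)) (bfs_row 0) (bfs_row n).
Proof.
apply: triple_iter => h hn.
apply: triple_seq (bfs_row_exit hn).
apply: triple_seq (bfs_row_enter hn) _.
by apply: triple_iter => k; apply: bfs_step.
Qed.

(** * Wiping the input matrix to make room for the output *)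

Definition clearing k c := exists s,
  [/\ fits W c /\ base (reg c),
      [/\ queue (cell c) s, marks (cell c) s & forall a, a < k -> cell c a = 0],
      tree_order s, forall x, x \in unzip1 s &
      [/\ pc c = if k < N then 29 else 32, reg c 6 = k & reg c 10 = 0]].

Lemma clearing_enter : triple W code 2 (bfs_row n) (clearing 0).
Proof.
have nN := n_lt_N; have NW := N_lt_W.
apply: triple_trace => -[q r m] [s]; cbv beta iota delta [reg cell pc] =>
  -[[fc [R0 R1 R2 R3 [R4 R16]]] [qu ma mx] [R5 R7 s1] [ts s0 ex] ->].
rewrite ltnn; split; first by [].
  by sim; repeat split; lia.
move=> ft; exists s; split.
- by split=> //; split=> //; sim.
- by split; sim.
- by [].
- by move=> x; apply: explored_all ex; rewrite // tree_order_size.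
- by sim; split=> //; case: ltnP => //; lia.
Qed.

Lemma clearing_step k : k < N -> triple W code 3 (clearing k) (clearing k.+1).
Proof.
move=> kN; have nN := n_lt_N; have NW := N_lt_W.
apply: triple_trace => -[q r m] [s]; cbv beta iota delta [reg cell pc] =>
  -[[fc [R0 R1 R2 R3 [R4 R16]]] [qu ma m0] ts sp [-> R6 R10]].
rewrite kN; split; first by [].
  by sim; rewrite !(R4, R6); repeat split; lia.
move=> ft; exists s; split.
- by split=> //; split=> //; sim.
- sim; rewrite !(R6, R10); split=> [i si|x|a]; rewrite /upd.
  + by have [<- <-] := qu i si; split; case: eqP => // ?; lia.
  + by rewrite -ma; case: eqP => // ?; lia.
  + by rewrite ltnS leq_eqVlt; case: eqP => //= _ /m0.
- by [].
- by [].
- by sim; rewrite !(R1, R4, R6, R10) addn1.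
Qed.

(** * Peeling the tree into a solution *)

Definition pending s i : {set V} := [set x in unzip1 (take i s)].

(** After [k] removals the first [n - k] queue entries are pending, and register 5 points at the
    last of them. The root at position 0 is never removed, which leaves [n - 1] passes; address 53
    is the end of the code. Flags are tracked for pending vertices only. *)
Definition peeling k c := exists s (X : {set {set V}}),
  [/\ fits W c /\ base (reg c),
      [/\ queue (cell c) s, matrix (cell c) [rel x y | [set x; y] \in X] &
          forall x, x \in pending s (n - k) ->
            cell c (N + rk x) = ~~ odd (deg X x)],
      tree_order s /\ size s = n,
      partial_join e (pending s (n - k)) X /\ #|X| <= k &
      pc c = (if k < n.-1 then 33 else 53) /\ reg c 5 = n.-1 - k].

Lemma peeling_enter : triple W code 1 (clearing N) (peeling 0).
Proof.
have nN := n_lt_N; have NW := N_lt_W.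
apply: triple_trace => -[q r m] [s]; cbv beta iota delta [reg cell pc] =>
  -[[fc [R0 R1 R2 R3 [R4 R16]]] [qu ma m0] ts sp [-> R6 R10]].
have sn := spanning_size ts sp.
have pT : pending s n = setT by apply/setP=> x; rewrite !inE -sn take_size sp.
rewrite ltnn; split=> //.
move=> ft; exists s, set0; rewrite subn0 pT; split.
- by split=> //; split=> //; sim.
- sim; split=> [|x y|x _]; first exact: qu.
  + by rewrite /= inE m0 ?pair_lt_N.
  + by rewrite deg0 ma sp.
- by [].
- by split; [apply: partial_join0 | rewrite cards0].
(* The loop is entered without a test, which is right because [n > 1]. *)
- by sim; rewrite !(R0, R4) subn1 subn0; case: ltnP => //; lia.
Qed.

(** A parent precedes its child in the queue, so it is still pending when the child, as the last
    pending entry, is removed. *)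
Lemma pending_split s i (v := (nth d s i).1) (u := (nth d s i).2) :
  tree_order s -> 0 < i < size s ->
  [/\ u \in pending s i, v \notin pending s i, e u v &
      pending s i.+1 = v |: pending s i].
Proof.
move=> [us par] /[dup] /par[up euv] /andP[_ lt]; split=> //.
- by rewrite inE.
- move: us; rewrite -{1}(cat_take_drop i.+1 s) (take_nth d) // -cats1 -catA.
  rewrite /unzip1 !map_cat cat_uniq /= => /and3P[_ + _].
  by rewrite inE negb_or => /andP[].
- apply/setP=> x; rewrite !inE (take_nth d) //.
  by rewrite /unzip1 map_rcons mem_rcons inE.
Qed.

Lemma upd_neq (f : nat -> nat) i a j : j != i -> upd f i a j = f j.
Proof. by rewrite /upd => /negbTE->. Qed.

Lemma low_neq a i : a < N ->
  [/\ (a == N + i) = false, (N + i == a) = false,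
      (2 * N + i == a) = false & (3 * N + i == a) = false].
Proof. by move=> aN; split; apply/eqP; lia. Qed.

(** No branch decides whether the edge is taken: the flag of [v] itself is written to both matrix
    entries of the edge and combined by exclusive or with the flag of [u]. *)
Lemma peeling_step k :
  k < n.-1 -> triple W code 20 (peeling k) (peeling k.+1).
Proof.
move=> kn; have nN := n_lt_N; have NW := N_lt_W.
apply: triple_trace => -[q r m] [s [X]]; cbv beta iota delta [reg cell pc] =>
  -[[fc [R0 R1 R2 R3 [R4 R16]]] [qu mx ma] [ts sn] [pj cX] [-> R5]].
have Ej : n - k = (n.-1 - k).+1 by lia.
have Ej' : n - k.+1 = n.-1 - k by lia.
rewrite Ej in ma pj; rewrite kn.
have js : 0 < n.-1 - k < size s by rewrite sn; lia.
have [Qv Qu] := qu _ (proj2 (andP js)).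
have [uP vP euv Epend] := pending_split ts js.
move: Qv Qu uP vP euv Epend; case: (nth d s (n.-1 - k)) => v u.
cbn [fst snd] => Qv Qu uP vP euv Epend.
have vS : v \in pending s (n.-1 - k).+1 by rewrite Epend setU11.
have uS : u \in pending s (n.-1 - k).+1 by rewrite Epend setU1r.
have [pj' cX' memX' degX'] := join_stepP e_irr vS uS euv pj.
have nuv := edge_neq e_irr euv.
have Mv := ma v vS; have Mu := ma u uS.
have vn := rk_lt v; have un := rk_lt u.
have uvN := pair_lt_N u v; have vuN := pair_lt_N v u.
(* Both matrix writes hit addresses below [N], so marks, queue and parents are unchanged. *)
have upd_high f a b i : [/\ upd (upd f (rk u * n + rk v) a) (rk v * n + rk u) b
        (N + i) = f (N + i),
    upd (upd f (rk u * n + rk v) a) (rk v * n + rk u) b (2 * N + i)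
      = f (2 * N + i) &
    upd (upd f (rk u * n + rk v) a) (rk v * n + rk u) b (3 * N + i)
      = f (3 * N + i)].
  have [_ u1 u2 u3] := low_neq i uvN; have [_ v1 v2 v3] := low_neq i vuN.
  by rewrite /upd u1 u2 u3 v1 v2 v3.

have Mu' a b : upd (upd m (rk u * n + rk v) a) (rk v * n + rk u) b (N + rk u)
    = ~~ odd (deg X u).
  by have [-> _ _] := upd_high m a b (rk u).
split; first by [].
  sim; rewrite !(R0, R1, R2, R3, R4, R5, Qv, Qu, Mv, Mu').
  move: (_ * n) (_ * n) (~~ _) (~~ _) uvN vuN => a b c1 c2 uvN vuN.
  by clear - uvN vuN c1 c2 un vn nN NW js sn; repeat split; lia.
move=> ft; exists s, (join_step u v X); rewrite Ej'.
have Pv : pending s (n.-1 - k).+1 :\ v = pending s (n.-1 - k).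
  by rewrite Epend setU1K.
rewrite Pv in pj'.
split.
- by split=> //; split=> //; sim.
- sim; rewrite !(R0, R1, R2, R3, R4, R5, Qv, Qu, Mv, Mu'); split.
  + move=> i si; have [<- <-] := qu i si.
    have [_ <- <-] := upd_high m (~~ odd (deg X v)) (~~ odd (deg X v)) i.
    by clear - un nN; split; apply: upd_neq; apply/eqP; lia.
  + move=> x y; rewrite /= memX' /upd.
    have [-> _ _ _] := low_neq (rk u) (pair_lt_N x y).
    by rewrite !rk_pair_inj mx; case: (_ && _); case: (_ && _).
  + move=> y yP.
    have yS : y \in pending s (n.-1 - k).+1 by rewrite Epend setU1r.
    have yv : y != v by apply: contraNneq vP => <-.
    rewrite (degX' y yv); case: (eqVneq y u) => [->|yu] /=.
      (* On bits, [(a - b) + (b - a)] with truncated subtraction is exclusive or. *)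
      by rewrite /upd eqxx; case: (odd _); case: (odd _).
    rewrite upd_neq ?eqn_add2l ?(inj_eq (@rk_inj V)) //.
    have [-> _ _] := upd_high m (~~ odd (deg X v)) (~~ odd (deg X v)) (rk y).
    by rewrite ma // addbF.
- by [].
- by split=> //; lia.
- sim; rewrite !(R4, R5, R16); clear - kn n_gt1.
  by split; [do 2!case: ifP|]; lia.
Qed.

Lemma triple_code : triple W code
  (6 + (n * (4 + n * 15 + 2) + (2 + (N * 3 + (1 + n.-1 * 20)))))
  start (peeling n.-1).
Proof.
apply: triple_seq start_step _; apply: triple_seq bfs_phase _.
apply: triple_seq clearing_enter _.
apply: triple_seq (triple_iter clearing_step) _.
exact: triple_seq peeling_enter (triple_iter peeling_step).
Qed.

End Algorithm.

(** * Word size, running time and assembly *)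

Lemma fits_input (V : finType) (e : rel V) W :
  #|V| < W -> 1 < W -> fits W (input e).
Proof.
move=> nW W1 i; split; first by rewrite /= /upd; case: eqP => // _; lia.
rewrite /=; case: (ltnP i (#|V| ^ 2)) => [/rk_pair[x [y ->]]|le].
  by rewrite nth_adj_matrix; case: (e x y); lia.
by rewrite nth_default ?size_adj_matrix //; lia.
Qed.

Theorem theorem3p4 :
  exists (p : program) (d : nat) (T : nat -> nat),
    bigO T (fun n : nat => n ^ 2) /\
    forall (V : finType) (e : rel V),
      symmetric e -> irreflexive e -> connected_graph e -> ~~ odd #|V| ->
      exists (t : nat) (c : config) (S : {set {set V}}),
        [/\ runs (#|V| ^ d) p t (input e) c,
            t <= T #|V|,
            outputs c S,
            solution e S &
            forall Sopt : {set {set V}}, optimal_solution e Sopt ->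
              (#|S|%:R <= 2 * (1 - #|V|%:R^-1) * #|Sopt|%:R :> rat)%R].
Proof.
(* The step bound adds up to [18 n^2 + 26 n - 11], so 60 is generous. The word bound [n ^ 4] is at
   least the required [4 * n ^ 2] because [n >= 2]. *)
exists code, 4, (fun n => 60 * n ^ 2); split; first by exists 60, 0.
move=> V e _ e_irr [n0 e_conn] n_even.
have n1 : 1 < #|V| by move: n0 n_even; case: #|V| => [|[]].
have nN : #|V| < #|V| ^ 2 by nia.
have NW : 4 * #|V| ^ 2 <= #|V| ^ 4.
  by rewrite (expnD _ 2 2) leq_mul2r (leq_sqr 2) n1 orbT.
have [x0 rk_x0] := rk_onto n0.
have [|t [c [le_t run]]] :=
    triple_code e_irr e_conn rk_x0 n1 (erefl _) nN NW (c := input e).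
  split=> //; first by split=> //; apply: fits_input; lia.
  - by move=> x y; rewrite /= nth_adj_matrix.
  - by move=> a le; rewrite /= nth_default ?size_adj_matrix.
case=> s [X [[fc _] [_ mx _] [ts sn] [pj cX] [pc_c _]]].
(* After [n - 1] removals only the root is pending, the situation of [partial_join1]. *)
have sol : solution e X.
  move: pj; have -> : #|V| - #|V|.-1 = 1 by lia.
  case: s ts sn {mx} => [|[r r'] s] ts sn; first by move: n0; rewrite -sn.
  have -> : pending ((r, r') :: s) 1 = [set r].
    by apply/setP=> x; rewrite /pending /= take0 !inE.
  exact: partial_join1.
exists t, c, X; split=> //.
- rewrite -[t]addn0; apply: run; apply: RunsHalt => //.
  by rewrite pc_c ltnn.
- by apply: leq_trans le_t _; nia.
- exact: outputs_mem.
- by move=> Y [solY _]; apply: join_ratio => //; lia.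
Qed.
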